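(* Every linear map $h:A\to A$ on a vector space $A$ admits a minimal injective linear dilation.
   Context: $\mathbb{Z}_+=\{0,1,2,\ldots\}$; for any self-map $f$, $f^0$ is the identity. Let $A$ be a vector space and $h:A\to A$ a linear map. An injective linear dilation of $h$ is a quadruple $(B,i,v,p)$ where $B$ is a vector space (over the same field), $i:A\to B$ and $v:B\to B$ are injective linear maps, and $p:B\to B$ is an idempotent linear map with $p(B)=i(A)$, satisfying $i(h^n(a))=p(v^n(i(a)))$ for all $n\in\mathbb{Z}_+$, $a\in A$. It is minimal if $B=\operatorname{span}\{v^n(i(a)):n\in\mathbb{Z}_+,\ a\in A\}$. *)

(* Defs.v *)
From mathcomp Require Import all_boot all_algebra.
From mathcomp Require Import classical_sets.

Set Implicit Arguments.
Unset Strict Implicit.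
Unset Printing Implicit Defensive.

Import GRing.Theory.
Local Open Scope classical_set_scope.
Local Open Scope ring_scope.

(* The span of MathComp's vector library only covers finite-dimensional
   spaces.  Taking n = 0 below puts 0 in the span of any set. *)
Definition linear_span (K : fieldType) (V : lmodType K) (S : set V) : set V :=
  [set x | exists (n : nat) (c : 'I_n -> K) (s : 'I_n -> V),
     (forall k, S (s k)) /\ x = \sum_(k < n) c k *: s k].

Record injective_linear_dilation (K : fieldType) (A : lmodType K)
    (h : {linear A -> A}) := InjectiveLinearDilation {
  dil_space : lmodType K;
  dil_i : {linear A -> dil_space};
  dil_v : {linear dil_space -> dil_space};
  dil_p : {linear dil_space -> dil_space};
  dil_i_inj : injective dil_i;
  dil_v_inj : injective dil_v;
  dil_p_idem : idempotent_fun dil_p;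
  dil_p_range : range dil_p = range dil_i;
  dil_eq : forall (n : nat) (a : A),
    dil_i (iter n h a) = dil_p (iter n dil_v (dil_i a))
}.

Definition minimal_dilation (K : fieldType) (A : lmodType K)
    (h : {linear A -> A}) (D : injective_linear_dilation h) : Prop :=
  linear_span [set iter n (dil_v D) (dil_i D a) | n in [set: nat] & a in [set: A]]
    = [set: dil_space D].

(* Main.v *)
Require Import Defs.
From HB Require Import structures.
From mathcomp Require Import all_boot all_algebra.
From mathcomp Require Import boolp classical_sets functions.

(** The dilation space is the space A[X] of polynomials with coefficients
    in A, with [v] multiplication by X, [i] the inclusion of the constants and
    [p] the evaluation at [h]: then [p (X^n a) = h^n a], and the [X^n a] span
    A[X].

    This space is used below in the coordinates given by repeated division by
    X - h: the element sum_n X^n a_n is stored as the finitely supported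
    sequence [f] with f_k = sum_(n >= k) h^(n - k) a_n.  In these coordinates
    evaluation at [h] is [f |-> f_0], so that [p] keeps the entry of index 0
    and erases the others, and multiplication by X is
    [(f_0, f_1, ...) |-> (h f_0, f_0, f_1, ...)], which is injective because
    it still displays [f] from index 1 on.  All sums disappear from the
    definitions and the dilation equation becomes a statement about entries
    of index 0 ([entry0_iter_hshift]).

    Minimality comes from [f = i (f_0 - h f_1) + v (f_1, f_2, ...)]: the
    sequence on the right has a shorter support, and iterating the equation
    writes [f] as a finite sum of vectors [v^n (i a)]
    ([hshift_expansion]). *)

Set Implicit Arguments.
Unset Strict Implicit.
Unset Printing Implicit Defensive.

Import GRing.Theory.
Local Open Scope ring_scope.

Section FinitelySupportedSequences.
Variables (K : fieldType) (A : lmodType K).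

Definition finsupp_seq : {pred nat -> A} :=
  fun f => `[< exists N, forall n, (N <= n)%N -> f n = 0 >].

Lemma finsupp_seqP (f : nat -> A) :
  reflect (exists N, forall n, (N <= n)%N -> f n = 0) (f \in finsupp_seq).
Proof. exact: asboolP. Qed.

Lemma finsupp_seq_submod_closed : submod_closed finsupp_seq.
Proof.
split; first by apply/finsupp_seqP; exists 0%N.
move=> c f g /finsupp_seqP[M fM] /finsupp_seqP[N gN].
apply/finsupp_seqP; exists (maxn M N) => n; rewrite geq_max => /andP[Mn Nn].
by rewrite !fctE fM // gN // scaler0 addr0.
Qed.

HB.instance Definition _ :=
  GRing.isSubmodClosed.Build K (nat -> A) finsupp_seq finsupp_seq_submod_closed.

Record fsseq := FSSeq { entry : nat -> A ; entryP : entry \in finsupp_seq }.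

HB.instance Definition _ := [isSub for entry].
HB.instance Definition _ := [Choice of fsseq by <:].
HB.instance Definition _ := [SubChoice_isSubLmodule of fsseq by <:].

Lemma fsseq_ext (f g : fsseq) : entry f =1 entry g -> f = g.
Proof. by move=> fg; apply/val_inj/funext. Qed.

Lemma entry_linearP c (f g : fsseq) n :
  entry (c *: f + g) n = c *: entry f n + entry g n.
Proof. by []. Qed.

Definition const_seq (a : A) : nat -> A := fun n => if n is 0 then a else 0.

Lemma const_seq_finsupp a : const_seq a \in finsupp_seq.
Proof. by apply/finsupp_seqP; exists 1%N; case. Qed.

Definition fsconst a : fsseq := FSSeq (const_seq_finsupp a).

Lemma fsconst_linear : linear fsconst.
Proof.
move=> c a b; apply: fsseq_ext => -[|n]; rewrite entry_linearP //=.
by rewrite scaler0 addr0.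
Qed.

HB.instance Definition _ := GRing.isLinear.Build K A fsseq _ fsconst fsconst_linear.

Lemma fsconst_inj : injective fsconst.
Proof. by move=> a b /(congr1 (entry^~ 0%N)). Qed.

(** Evaluation of polynomials at [h], followed by the inclusion of constants:
    the evaluation is the remainder of the division by X - h, which is the
    entry of index 0. *)
Definition fsproj (f : fsseq) : fsseq := fsconst (entry f 0).

Lemma fsproj_linear : linear fsproj.
Proof. by move=> c f g; rewrite /fsproj entry_linearP linearP. Qed.

HB.instance Definition _ :=
  GRing.isLinear.Build K fsseq fsseq _ fsproj fsproj_linear.

Lemma range_fsproj : range fsproj = range fsconst.
Proof.
apply/seteqP; split=> [_ [f _ <-]|_ [a _ <-]]; first by exists (entry f 0).
by exists (fsconst a).
Qed.

Definition tail_seq (f : nat -> A) : nat -> A := fun n => f n.+1.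

Lemma tail_seq_finsupp (f : fsseq) : tail_seq (entry f) \in finsupp_seq.
Proof.
have /finsupp_seqP[N fN] := entryP f.
by apply/finsupp_seqP; exists N => n Nn; apply: fN; apply: leqW.
Qed.

Definition fstail f : fsseq := FSSeq (tail_seq_finsupp f).

Variable h : {linear A -> A}.

(** Multiplication by X in the coordinates given by division by X - h. *)
Definition hshift_seq (f : nat -> A) : nat -> A :=
  fun n => if n is m.+1 then f m else h (f 0%N).

Lemma hshift_seq_finsupp (f : fsseq) : hshift_seq (entry f) \in finsupp_seq.
Proof.
have /finsupp_seqP[N fN] := entryP f.
by apply/finsupp_seqP; exists N.+1 => -[|n] // Nn; apply: fN.
Qed.

Definition hshift f : fsseq := FSSeq (hshift_seq_finsupp f).

Lemma hshift_linear : linear hshift.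
Proof.
move=> c f g; apply: fsseq_ext => -[|n]; rewrite entry_linearP //=.
by rewrite linearP.
Qed.

HB.instance Definition _ :=
  GRing.isLinear.Build K fsseq fsseq _ hshift hshift_linear.

Lemma hshift_inj : injective hshift.
Proof.
by move=> f g fg; apply: fsseq_ext => n; have /(congr1 (entry^~ n.+1)) := fg.
Qed.

(** Evaluation at [h] intertwines multiplication by X with [h]; on constants
    this is the dilation equation. *)
Lemma entry0_iter_hshift n f : entry (iter n hshift f) 0 = iter n h (entry f 0).
Proof. by elim: n => //= n ->. Qed.

(** One step of the expansion of [f] along powers of X: the first summand is
    the constant term of the polynomial that [f] stands for, and the second is
    the multiple of X that remains. *)
Lemma hshift_fstail f :
  f = fsconst (entry f 0 - h (entry f 1)) + hshift (fstail f).
Proof.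
apply: fsseq_ext => n; rewrite -[fsconst _]scale1r entry_linearP scale1r.
by case: n => [|n] /=; rewrite ?subrK ?add0r.
Qed.

(** The coefficients [entry f k - h (entry f k.+1)] are those of the polynomial
    that [f] stands for. *)
Lemma hshift_expansion N f : (forall n, (N <= n)%N -> entry f n = 0) ->
  f = \sum_(k < N) iter k hshift (fsconst (entry f k - h (entry f k.+1))).
Proof.
elim: N f => [|N IHN] f fN.
  by rewrite big_ord0; apply: fsseq_ext => n; apply: fN.
rewrite big_ord_recl {1}[f]hshift_fstail; congr (_ + _).
rewrite [fstail f]IHN; last by move=> n Nn; apply: fN.
by rewrite linear_sum.
Qed.

Definition polynomial_dilation : injective_linear_dilation h.
Proof.
apply: (@InjectiveLinearDilation K A h fsseq fsconst hshift fsproj).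
- exact: fsconst_inj.
- exact: hshift_inj.
- by move=> f.
- exact: range_fsproj.
- by move=> n a; rewrite /= /fsproj entry0_iter_hshift.
Defined.

Lemma polynomial_dilation_minimal : minimal_dilation polynomial_dilation.
Proof.
apply/seteqP; split=> // f _.
have /finsupp_seqP[N fN] := entryP f.
exists N, (fun=> 1),
  (fun k : 'I_N => iter k hshift (fsconst (entry f k - h (entry f k.+1)))).
split=> [k|]; first by exists k => //; eexists.
by rewrite {1}(hshift_expansion fN); apply: eq_bigr => k _; rewrite scale1r.
Qed.

End FinitelySupportedSequences.

Theorem theorem4p3 (K : fieldType) (A : lmodType K) (h : {linear A -> A}) :
  exists D : injective_linear_dilation h, minimal_dilation D.
Proof.
by exists (polynomial_dilation h); apply: polynomial_dilation_minimal.
Qed.
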